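(* Let $R$ be an arbitrary (possibly non-commutative) ring with $1$ and let $A\in\mathrm{M}_3(R)$. Then the symmetric characteristic polynomial of $A$ in $R[z]$ is $$p_{A,1}(z)=q_{A,1}(z)=\mathrm{sdet}(zI-A)=6z^{3}-6\,\mathrm{tr}(A)z^{2}+3\left(\mathrm{tr}^{2}(A)-\mathrm{tr}(A^{2})\right)z-\mathrm{sdet}(A).$$
   Context: $R[z]$ is the ring of polynomials in a single indeterminate $z$ commuting with the coefficients from $R$; $I$ is the identity matrix; $\mathrm{tr}$ denotes the sum of the diagonal entries and $\mathrm{tr}^2(A)=(\mathrm{tr}(A))^2$. For a ring $S$ with $1$ and $B=[b_{i,j}]\in\mathrm{M}_n(S)$, the symmetric determinant is $$\mathrm{sdet}(B)=\sum_{\alpha,\beta\in\mathrm{S}_n}\mathrm{sgn}(\alpha)\,\mathrm{sgn}(\beta)\,b_{\alpha(1),\beta(1)}\cdots b_{\alpha(n),\beta(n)},$$ where $\mathrm{S}_n$ is the symmetric group on $\{1,\dots,n\}$. The preadjoint matrix $B^{\ast}=[b^{\ast}_{r,s}]$ is defined by $$b^{\ast}_{r,s}=\sum_{\alpha,\beta}\mathrm{sgn}(\alpha)\,\mathrm{sgn}(\beta)\,b_{\alpha(1),\beta(1)}\cdots b_{\alpha(s-1),\beta(s-1)}\,b_{\alpha(s+1),\beta(s+1)}\cdots b_{\alpha(n),\beta(n)},$$ the sum being over all $\alpha,\beta\in\mathrm{S}_n$ with $\alpha(s)=s$ and $\beta(s)=r$. The first right and left determinants are $\mathrm{rdet}_{(1)}(B)=\mathrm{tr}(BB^{\ast})$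 and $\mathrm{ldet}_{(1)}(B)=\mathrm{tr}(B^{\ast}B)$. The first right and first left characteristic polynomials of $A\in\mathrm{M}_n(R)$ are $p_{A,1}(z)=\mathrm{rdet}_{(1)}(zI-A)$ and $q_{A,1}(z)=\mathrm{ldet}_{(1)}(zI-A)$, computed in $\mathrm{M}_n(R[z])$. *)

(* Defs.v *)
From mathcomp Require Import all_boot all_fingroup all_algebra.

Set Implicit Arguments.
Unset Strict Implicit.
Unset Printing Implicit Defensive.

Import GRing.Theory.
Local Open Scope ring_scope.

(* The entries need not commute, so the order of the factors matters below:
   a product over 'I_n, filtered or not, multiplies its factors from left to
   right by increasing index. *)

Definition sdet (S : pzRingType) (n : nat) (B : 'M[S]_n) : S :=
  \sum_(alpha : 'S_n) \sum_(beta : 'S_n)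
    (-1) ^+ alpha * (-1) ^+ beta * \prod_(i < n) B (alpha i) (beta i).

Definition preadj (S : pzRingType) (n : nat) (B : 'M[S]_n) : 'M[S]_n :=
  \matrix_(r, s)
    \sum_(alpha : 'S_n | alpha s == s) \sum_(beta : 'S_n | beta s == r)
      (-1) ^+ alpha * (-1) ^+ beta
        * \prod_(i < n | i != s) B (alpha i) (beta i).

Definition rdet1 (S : pzRingType) (n : nat) (B : 'M[S]_n) : S :=
  \tr (B *m preadj B).

Definition ldet1 (S : pzRingType) (n : nat) (B : 'M[S]_n) : S :=
  \tr (preadj B *m B).

(* char_poly_mx A is zI - A, with entries in {poly R}. *)
Definition rchar_poly1 (R : nzRingType) (n : nat) (A : 'M[R]_n) : {poly R} :=
  rdet1 (char_poly_mx A).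

Definition lchar_poly1 (R : nzRingType) (n : nat) (A : 'M[R]_n) : {poly R} :=
  ldet1 (char_poly_mx A).

(* Main.v *)
Require Import Defs.
From mathcomp Require Import all_boot all_fingroup all_algebra.
From mathcomp Require Import zify.

Set Implicit Arguments.
Unset Strict Implicit.
Unset Printing Implicit Defensive.

Import GRing.Theory.
Local Open Scope ring_scope.

(** For every [n > 0], both first determinants equal the symmetric determinant.
    In the product attached to a pair of permutations [(a, b)], the factor in
    position [k] is the entry [B (a k) (b k)].  Fixing [a k = i] and [b k = j],
    the remaining positions give the term of a pair of permutations of one
    point less in the minor deleting row [i] and column [j], with the sign
    [(-1) ^+ (i + j)] whatever [k] is: changing the position of the isolated
    factor moves both permutations by the same cycle, and the two signs cancel.
    With [k] the first position this expands [sdet B] as [\tr (B *m preadj B)],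
    with [k] the last one as [\tr (preadj B *m B)]: [rdet1_sdet],
    [ldet1_sdet].

    For the coefficients, [sdet] in size 3 is the diagonal of a trilinear form
    [tdet], with one matrix for each position.  Expanding along a position
    occupied by a central scalar matrix [x%:M] leaves [x] times the sum of the
    polarised principal 2-minors of the other two matrices [B], [C], in their
    order; this is [x * (\tr B * \tr C - \tr (B *m C))], independently of the
    position ([tdet_scalar0], [tdet_scalar1], [tdet_scalar2]).  Expand [tdet]
    at [x%:M - A] in all three positions: the term without [A] is
    [x ^+ 3 *+ 6], the three terms with [A] once contribute
    [- x ^+ 2 * (\tr A *+ 2)] each, the three terms with [A] twice
    [x * ((\tr A) ^+ 2 - \tr (A ^+ 2))] each, and the term with [A] alone is
    [- sdet A] ([sdet_scalar_sub]).  It remains to take [x := 'X], which is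
    central in the polynomial ring. *)

(** * Isolating one position of a permutation *)

(** Choosing a permutation of [n.+1] points amounts to choosing the image of
    [k] and a permutation of the other points; injectivity and a count of both
    sides give the bijection. *)
Lemma sum_lift_perm (V : nmodType) n (k : 'I_n.+1) (F : 'S_n.+1 -> V) :
  \sum_(s : 'S_n.+1) F s
    = \sum_(i < n.+1) \sum_(t : 'S_n) F (lift_perm k i t).
Proof.
rewrite pair_big /= (reindex (fun p => lift_perm k p.1 p.2)) //=.
apply/onW_bij/inj_card_bij; last first.
  by rewrite card_prod !card_Sn card_ord.
move=> [i t] [j u] /= eq_tu.
have eq_ij : i = j by rewrite -(lift_perm_id k i t) eq_tu lift_perm_id.
rewrite -{}eq_ij {j} in eq_tu *; congr pair; apply/permP=> l.
by apply: (@lift_inj _ i); rewrite -!(lift_perm_lift k) eq_tu.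
Qed.

Lemma sum_lift_perm_fixed (V : nmodType) n (k j : 'I_n.+1)
    (F : 'S_n.+1 -> V) :
  \sum_(s : 'S_n.+1 | s k == j) F s = \sum_(t : 'S_n) F (lift_perm k j t).
Proof.
rewrite big_mkcond (sum_lift_perm k) (bigD1 j) //=.
rewrite [X in _ + X]big1 ?addr0 => [|i ne_ij].
  by apply: eq_bigr => t _; rewrite lift_perm_id eqxx.
by apply: big1 => t _; rewrite lift_perm_id (negPf ne_ij).
Qed.

Lemma sum_lift_perm2 (V : nmodType) n (k : 'I_n.+1)
    (F : 'S_n.+1 -> 'S_n.+1 -> V) :
  \sum_(s : 'S_n.+1) \sum_(t : 'S_n.+1) F s t
    = \sum_(i < n.+1) \sum_(j < n.+1) \sum_(s : 'S_n) \sum_(t : 'S_n)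
        F (lift_perm k i s) (lift_perm k j t).
Proof.
rewrite (sum_lift_perm k); apply: eq_bigr => i _.
rewrite [RHS]exchange_big; apply: eq_bigr => s _.
exact: sum_lift_perm.
Qed.

(** The contribution of [k] appears twice, hence cancels: this is why a factor
    can be isolated in any position at the same cost. *)
Lemma sign_lift_perm2 (S : pzRingType) n (k i j : 'I_n.+1) (s t : 'S_n) :
  (-1) ^+ lift_perm k i s * (-1) ^+ lift_perm k j t
    = (-1) ^+ (i + j) * ((-1) ^+ s * (-1) ^+ t) :> S.
Proof.
rewrite !odd_lift_perm -!signr_addb -[(-1) ^+ (i + j)]signr_odd oddD.
rewrite -signr_addb; congr (_ ^+ nat_of_bool _).
by case: (odd k) (odd i) (odd j) (s : bool) (t : bool) => [] [] [] [] [].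
Qed.

(** The law need not be commutative, so reindexing does not suffice: the point
    is that [lift k] enumerates the indices other than [k] in increasing
    order. *)
Lemma big_neq_lift (T : Type) (idx : T) (op : Monoid.law idx) n (k : 'I_n.+1)
    (F : 'I_n.+1 -> T) :
  \big[op/idx]_(i < n.+1 | i != k) F i = \big[op/idx]_(i < n) F (lift k i).
Proof.
rewrite -big_filter -(big_map (lift k) xpredT F); congr bigop.
pose lt_ord m := relpre (@nat_of_ord m) ltn.
have sorted_ord m : sorted (@lt_ord m) (index_enum 'I_m).
  by rewrite -sorted_map /index_enum -enumT val_enum_ord iota_ltn_sorted.
have lt_ord_trans m : transitive (@lt_ord m) by move=> i j l; apply: ltn_trans.
apply: (irr_sorted_eq (lt_ord_trans _)) => [i||| i]; rewrite /= ?ltnn //.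
- by apply: sorted_filter.
- apply: (homo_sorted (e := @lt_ord n)) => // i j.
  by rewrite /lt_ord /= /bump; lia.
rewrite mem_filter mem_index_enum andbT.
apply/idP/mapP => [|[j _ ->]]; last by rewrite eq_sym neq_lift.
case: (unliftP k i) => [j ->|->]; rewrite ?eqxx // => _.
by exists j; rewrite ?mem_index_enum.
Qed.

(** * Both first determinants are the symmetric determinant *)

Lemma preadj_cofactor (S : pzRingType) n (B : 'M[S]_n.+1) r s :
  preadj B r s = (-1) ^+ (s + r) * sdet (row' s (col' r B)).
Proof.
rewrite mxE sum_lift_perm_fixed /sdet mulr_sumr; apply: eq_bigr => a _.
rewrite sum_lift_perm_fixed mulr_sumr; apply: eq_bigr => b _.
rewrite sign_lift_perm2 -[LHS]mulrA big_neq_lift; congr (_ * (_ * _)).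
by apply: eq_bigr => i _; rewrite !mxE !lift_perm_lift.
Qed.

Lemma commr_sign2 (S : pzRingType) (x : S) m (a b : bool) :
  x * ((-1) ^+ m * ((-1) ^+ a * (-1) ^+ b))
    = (-1) ^+ m * ((-1) ^+ a * (-1) ^+ b) * x.
Proof. by rewrite -!exprD; apply: commr_sign. Qed.

(** Isolating the first position leaves its factor on the left of the other
    ones, with only a sign, which is central, to move across it. *)
Lemma sdet_laplace_first (S : pzRingType) n (B : 'M[S]_n.+1) :
  sdet B = \sum_i \sum_j B i j * preadj B j i.
Proof.
rewrite /sdet (sum_lift_perm2 ord0).
apply: eq_bigr => i _; apply: eq_bigr => j _.
rewrite preadj_cofactor /sdet !mulr_sumr; apply: eq_bigr => a _.
rewrite !mulr_sumr; apply: eq_bigr => b _.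
rewrite sign_lift_perm2 big_ord_recl !lift_perm_id !mulrA.
rewrite -[in RHS](mulrA _ (_ ^+ a)) -[in RHS](mulrA _ (_ ^+ (i + j))).
rewrite commr_sign2.
rewrite !mulrA; congr (_ * _).
by apply: eq_bigr => l _; rewrite !mxE !lift_perm_lift.
Qed.

Lemma sdet_laplace_last (S : pzRingType) n (B : 'M[S]_n.+1) :
  sdet B = \sum_i \sum_j preadj B j i * B i j.
Proof.
rewrite /sdet (sum_lift_perm2 ord_max).
apply: eq_bigr => i _; apply: eq_bigr => j _.
rewrite preadj_cofactor /sdet mulr_sumr mulr_suml; apply: eq_bigr => a _.
rewrite mulr_sumr mulr_suml; apply: eq_bigr => b _.
rewrite sign_lift_perm2 big_ord_recr /= !lift_perm_id !mulrA.
congr (_ * _ * _); apply: eq_bigr => l _.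
have -> : widen_ord (leqnSn n) l = lift ord_max l.
  by apply: val_inj; rewrite /= /bump leqNgt ltn_ord.
by rewrite !mxE !lift_perm_lift.
Qed.

Lemma rdet1_sdet (S : pzRingType) n (B : 'M[S]_n.+1) : rdet1 B = sdet B.
Proof. by rewrite sdet_laplace_first; apply: eq_bigr => i _; rewrite mxE. Qed.

Lemma ldet1_sdet (S : pzRingType) n (B : 'M[S]_n.+1) : ldet1 B = sdet B.
Proof.
rewrite sdet_laplace_last exchange_big.
by apply: eq_bigr => i _; rewrite mxE.
Qed.

(** * The trilinear form behind the symmetric determinant of size 3 *)

Definition slot0 : 'I_3 := ord0.
Definition slot1 : 'I_3 := lift ord0 ord0.
Definition slot2 : 'I_3 := lift ord0 (lift ord0 ord0).

(** The matrices keep their positions in the products: this polarisation is not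
    symmetrised over the order of its arguments. *)
Definition tdet (S : pzRingType) (B C D : 'M[S]_3) : S :=
  \sum_(a : 'S_3) \sum_(b : 'S_3)
    (-1) ^+ a * (-1) ^+ b * (B (a slot0) (b slot0) *
      (C (a slot1) (b slot1) * D (a slot2) (b slot2))).

Lemma sdet_tdet (S : pzRingType) (B : 'M[S]_3) : sdet B = tdet B B B.
Proof.
apply: eq_bigr => a _; apply: eq_bigr => b _.
by rewrite !big_ord_recl big_ord0 mulr1.
Qed.

Lemma tdetBl (S : pzRingType) (B B' C D : 'M[S]_3) :
  tdet (B - B') C D = tdet B C D - tdet B' C D.
Proof.
rewrite /tdet -sumrB; apply: eq_bigr => a _; rewrite -sumrB.
by apply: eq_bigr => b _; rewrite !mxE mulrBl mulrBr.
Qed.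

Lemma tdetBm (S : pzRingType) (B C C' D : 'M[S]_3) :
  tdet B (C - C') D = tdet B C D - tdet B C' D.
Proof.
rewrite /tdet -sumrB; apply: eq_bigr => a _; rewrite -sumrB.
by apply: eq_bigr => b _; rewrite !mxE mulrBl !mulrBr.
Qed.

Lemma tdetBr (S : pzRingType) (B C D D' : 'M[S]_3) :
  tdet B C (D - D') = tdet B C D - tdet B C D'.
Proof.
rewrite /tdet -sumrB; apply: eq_bigr => a _; rewrite -sumrB.
by apply: eq_bigr => b _; rewrite !mxE !mulrBr.
Qed.

(** The polarisation of the principal minor on [i] and [j]; its vanishing for
    [i = j] lets sums over distinct indices become sums over all pairs, which
    are traces. *)
Definition minor2 (S : pzRingType) n (B C : 'M[S]_n) i j : S :=
  B i i * C j j - B i j * C j i.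

Lemma sum_S2 (V : nmodType) (F : 'S_2 -> V) :
  \sum_(s : 'S_2) F s = F 1%g + F (tperm ord0 ord_max).
Proof.
rewrite (sum_lift_perm ord0) !big_ord_recl big_ord0 addr0.
have sum_S1 (G : 'S_1 -> V) : \sum_s G s = G 1%g.
  rewrite (bigD1 1%g) //= big1 ?addr0 // => s.
  by rewrite permS1 eqxx.
rewrite !sum_S1 lift_perm1; congr (_ + F _).
apply/permP=> i; case: (unliftP ord0 i) => [j|] -> /=.
  rewrite lift_perm_lift perm1 [j]ord1.
  by rewrite (_ : lift ord0 0 = ord_max) ?tpermR; apply: val_inj.
by rewrite lift_perm_id tpermL; apply: val_inj.
Qed.

(** The left-hand side is what is left of [tdet] once a position is isolated,
    [f] being the embedding of the two other indices. *)
Lemma sum_S2_minors (S : pzRingType) n (B C : 'M[S]_n) (f : 'I_2 -> 'I_n) :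
  \sum_(a : 'S_2) \sum_(b : 'S_2) (-1) ^+ a * (-1) ^+ b *
     (B (f (a ord0)) (f (b ord0)) * C (f (a ord_max)) (f (b ord_max)))
    = minor2 B C (f ord0) (f ord_max) + minor2 B C (f ord_max) (f ord0).
Proof.
rewrite !sum_S2 !perm1 !tpermL !tpermR !odd_perm1 !odd_tperm /=.
rewrite !expr0 !expr1 !mulr1 !mul1r mulrN1 opprK !mulN1r !mul1r.
by rewrite /minor2 [X in _ + X]addrC.
Qed.

Lemma sum_minors2 (S : pzRingType) n (B C : 'M[S]_n) :
  \tr B * \tr C - \tr (B *m C) = \sum_i \sum_j minor2 B C i j.
Proof.
rewrite mulr_suml -sumrB; apply: eq_bigr => i _.
by rewrite mulr_sumr mxE -sumrB.
Qed.

(** An ordered pair of distinct indices among three is the complement of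
    exactly one index, so the left-hand side runs once over all such pairs. *)
Lemma sum_complementary_minors (S : pzRingType) (B C : 'M[S]_3) :
  \sum_(i < 3) (minor2 B C (lift i ord0) (lift i ord_max)
                + minor2 B C (lift i ord_max) (lift i ord0))
    = \tr B * \tr C - \tr (B *m C).
Proof.
have minor_diag i : minor2 B C i i = 0 by rewrite /minor2 subrr.
rewrite sum_minors2 !big_ord_recl !big_ord0 !minor_diag !addr0 !add0r.
(* Both sides are now the same six minors, once the indices are named. *)
have -> : lift ord0 (ord_max : 'I_2) = slot2 by apply: val_inj.
have -> : lift (lift ord0 ord0) (ord0 : 'I_2) = slot0 by apply: val_inj.
have -> : lift (lift ord0 ord0) (ord_max : 'I_2) = slot2 by apply: val_inj.
have -> : lift (lift ord0 (lift ord0 ord0)) (ord0 : 'I_2) = slot0.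
  by apply: val_inj.
have -> : lift (lift ord0 (lift ord0 ord0)) (ord_max : 'I_2) = slot1.
  by apply: val_inj.
by rewrite -/slot1 -/slot2 -/slot0 [LHS](AC (2*(2*2)) (5*3*6*1*4*2)) /= !addrA.
Qed.

(** * Scalar arguments *)

(** Off-diagonal entries of [x%:M] kill the terms with [a k != b k]; for the
    others the sign [(-1) ^+ (i + i)] is trivial, and what remains is the
    complementary principal minor. *)
Lemma sum_scalar_slot (S : pzRingType) (k : 'I_3) (x : S) (B C : 'M[S]_3) :
  (forall y, GRing.comm x y) ->
  \sum_(a : 'S_3) \sum_(b : 'S_3) (-1) ^+ a * (-1) ^+ b *
     (x%:M (a k) (b k) *
       (B (a (lift k ord0)) (b (lift k ord0)) *
        C (a (lift k ord_max)) (b (lift k ord_max))))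
    = x * (\tr B * \tr C - \tr (B *m C)).
Proof.
move=> xC; rewrite (sum_lift_perm2 k).
rewrite -sum_complementary_minors mulr_sumr; apply: eq_bigr => i _.
rewrite (bigD1 i) //= [X in _ + X]big1 => [|j ne_ji]; last first.
  apply: big1 => a _; apply: big1 => b _.
  by rewrite !lift_perm_id mxE eq_sym (negPf ne_ji) mul0r mulr0.
rewrite addr0 -sum_S2_minors mulr_sumr; apply: eq_bigr => a _.
rewrite mulr_sumr; apply: eq_bigr => b _.
rewrite sign_lift_perm2 !lift_perm_id mxE eqxx mulr1n !lift_perm_lift.
rewrite addnn -signr_odd odd_double mul1r.
by rewrite [RHS]mulrA [in RHS](xC (_ * _)) -[RHS]mulrA.
Qed.

Lemma tdet_scalar0 (S : pzRingType) (x : S) (B C : 'M[S]_3) :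
  (forall y, GRing.comm x y) ->
  tdet x%:M B C = x * (\tr B * \tr C - \tr (B *m C)).
Proof.
move=> xC; rewrite -(sum_scalar_slot slot0) //.
apply: eq_bigr => a _; apply: eq_bigr => b _.
by rewrite (_ : lift slot0 ord_max = slot2) //; apply: val_inj.
Qed.

Lemma comm_scalar_mx_entry (S : pzRingType) n (x : S) (i j : 'I_n) (y : S) :
  GRing.comm x y -> x%:M i j * y = y * x%:M i j.
Proof. by move=> xy; rewrite mxE mulrnAl mulrnAr xy. Qed.

Lemma tdet_scalar1 (S : pzRingType) (x : S) (B C : 'M[S]_3) :
  (forall y, GRing.comm x y) ->
  tdet B x%:M C = x * (\tr B * \tr C - \tr (B *m C)).
Proof.
move=> xC; rewrite -(sum_scalar_slot slot1) //.
apply: eq_bigr => a _; apply: eq_bigr => b _.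
have -> : lift slot1 ord0 = slot0 by apply: val_inj.
have -> : lift slot1 ord_max = slot2 by apply: val_inj.
congr (_ * _).
by rewrite [RHS]mulrA [in RHS]comm_scalar_mx_entry // -[RHS]mulrA.
Qed.

Lemma tdet_scalar2 (S : pzRingType) (x : S) (B C : 'M[S]_3) :
  (forall y, GRing.comm x y) ->
  tdet B C x%:M = x * (\tr B * \tr C - \tr (B *m C)).
Proof.
move=> xC; rewrite -(sum_scalar_slot slot2) //.
apply: eq_bigr => a _; apply: eq_bigr => b _.
have -> : lift slot2 ord0 = slot0 by apply: val_inj.
have -> : lift slot2 ord_max = slot1 by apply: val_inj.
by congr (_ * _); rewrite [RHS]comm_scalar_mx_entry // mulrA.
Qed.

(** * The characteristic polynomial *)

(** The expansion over a base ring with a central element [x]: arguments [x%:M]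
    still present in a trace give [\tr x%:M = x *+ 3], so a second scalar
    argument leaves [x ^+ 2 * (3 - 1) * \tr A] and a third one
    [x ^+ 3 * (9 - 3)]. *)
Lemma sdet_scalar_sub (S : pzRingType) (x : S) (A : 'M[S]_3) :
  (forall y, GRing.comm x y) ->
  sdet (x%:M - A) = x ^+ 3 *+ 6 - x ^+ 2 * (\tr A *+ 6)
    + x * (((\tr A) ^+ 2 - \tr (A ^+ 2)) *+ 3) - sdet A.
Proof.
move=> xC.
rewrite sdet_tdet tdetBl !tdetBm !tdetBr -(sdet_tdet A).
rewrite !(tdet_scalar0 _ _ xC) !(tdet_scalar1 _ _ xC) !(tdet_scalar2 _ _ xC).
have Ax : A *m x%:M = x *: A.
  by rewrite -diag_const_mx mul_mx_diag; apply/matrixP=> i j; rewrite !mxE xC.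
rewrite !mul_scalar_mx Ax !mxtraceZ mxtrace_scalar.
(* The two scalar contributions, product of traces and trace of product. *)
have sub3 (y : S) : y *+ 3 - y = y *+ 2 by rewrite mulrSr addrK.
rewrite !mulrnAr !mulrnAl -[\tr A * x]xC !sub3 -mulrnA !mulrnAr -expr2 -exprS.
rewrite !mulrA -expr2 -[\tr A * \tr A]expr2 -[A *m A]/(A ^+ 2).
set u := x ^+ 2 * \tr A; set v := x * (_ - _).
rewrite -[6%N]/(2 + (2 + 2))%N -[X in v *+ X]/(1 + (1 + 1))%N !mulrnDr mulr1n.
by rewrite !opprD !opprK !addrA !(addrAC _ v (- u)).
Qed.

Lemma sdet_map (S T : pzRingType) (f : {rmorphism S -> T}) n (A : 'M[S]_n) :
  sdet (map_mx f A) = f (sdet A).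
Proof.
rewrite /sdet rmorph_sum; apply: eq_bigr => a _.
rewrite rmorph_sum; apply: eq_bigr => b _.
rewrite !rmorphM !rmorph_sign rmorph_prod; congr (_ * _).
by apply: eq_bigr => i _; rewrite mxE.
Qed.

Theorem theorem6p4 (R : nzRingType) (A : 'M[R]_3) :
  [/\ rchar_poly1 A = lchar_poly1 A,
      lchar_poly1 A = sdet (char_poly_mx A)
    & sdet (char_poly_mx A) =
        6%:R *: 'X^3 - (6%:R * \tr A) *: 'X^2
        + (3%:R * ((\tr A) ^+ 2 - \tr (A ^+ 2))) *: 'X - (sdet A)%:P].
Proof.
rewrite /rchar_poly1 /lchar_poly1 rdet1_sdet ldet1_sdet; split=> //.
rewrite sdet_scalar_sub ?(sdet_map polyC); last first.
  by move=> p; apply/commr_sym/commr_polyX.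
rewrite -[map_mx _ A ^+ 2]map_mxM !trace_map_mx -['X * _]commr_polyX.
rewrite -['X^2 * _]commr_polyXn scaler_nat !mulr_natl -!mul_polyC.
by rewrite !polyCMn polyCB rmorphXn.
Qed.
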